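(* Let $(E,\mathcal A,\mu)$ be a finite measure space and let $B=(B_x)_{x\in E}$ be a centered, jointly measurable Gaussian field with $B_x\sim N(0,1)$ for every $x\in E$ and covariance kernel $K(x,y)=\mathbb E[B_xB_y]$. Suppose that there exists $\beta>0$ such that $$\int_{E^2}K(x,y)^q\,\mu(dx)\,\mu(dy)\asymp q^{-\beta}\qquad (q\to\infty).$$ Then for every $u\in\mathbb R$ and every $p\in\mathbb N$: $V(u)\in\mathbb D^{p,2}$ if and only if $p<\beta+\tfrac12$.
   Context: Hermite polynomials: $H_0(x)=1$, $H_1(x)=x$, $H_{q+1}(x)=xH_q(x)-qH_{q-1}(x)$. Let $\phi(x)=e^{-x^2/2}/\sqrt{2\pi}$. For $\varphi\in L^2(\mathbb R,\phi(x)dx)$ set $a_q(\varphi)=\frac1{q!}\int_{\mathbb R}H_q(x)\varphi(x)\phi(x)\,dx$, and define the functional $Y(\varphi)=\int_E\varphi(B_x)\,\mu(dx)$, whose $q$-th chaotic component is $Y(\varphi)[q]=a_q(\varphi)\int_E H_q(B_x)\,\mu(dx)$, with $\mathrm{Var}(Y(\varphi)[q])=q!\,a_q(\varphi)^2\int_{E^2}K(x,y)^q\mu(dx)\mu(dy)$. For $p\in\mathbb N$, we say $Y(\varphi)\in\mathbb D^{p,2}$ (has $p$-th square integrable Malliavin derivative) iff $\sum_{q\ge0}q^p\,q!\,a_q(\varphi)^2\int_{E^2}K(x,y)^q\,\mu(dx)\mu(dy)<\infty$. The excursion measure at level $u$ is $V(u)=\int_E\mathbf 1_{\{B_x\ge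 u\}}\mu(dx)=Y(\mathbf 1_{[u,\infty)})$. Notation: for positive functions, $f(q)\asymp g(q)$ means $\limsup_{q\to\infty} f(q)/g(q)<\infty$ and $\limsup_{q\to\infty} g(q)/f(q)<\infty$ (both ratios eventually bounded). *)

(* Defs.v *)
From HB Require Import structures.
From mathcomp Require Import all_boot all_order all_algebra.
From mathcomp Require Import all_classical all_reals all_analysis.
Set Implicit Arguments. Unset Strict Implicit. Unset Printing Implicit Defensive.
Import Order.TTheory GRing.Theory Num.Theory.
Import numFieldNormedType.Exports.
Local Open Scope classical_set_scope.
Local Open Scope ring_scope.

Section defs.
Context {R : realType}.

(* Probabilists' Hermite polynomials: H_0 = 1, H_1 = x,
   H_{q+1} = x H_q - q H_{q-1}.  hermite_pair q x = (H_q x, H_{q+1} x). *)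
Fixpoint hermite_pair (q : nat) (x : R) : R * R :=
  match q with
  | 0 => (1, x)
  | q'.+1 => let: (a, b) := hermite_pair q' x in (b, x * b - q'.+1%:R * a)
  end.
Definition hermite (q : nat) (x : R) : R := (hermite_pair q x).1.

Definition gauss_density (x : R) : R := expR (- (x ^+ 2) / 2) / Num.sqrt (pi *+ 2).

Definition hermite_coef (varphi : R -> R) (q : nat) : R :=
  (q`!%:R)^-1 *
  fine (\int[@lebesgue_measure R]_(x in setT)
          ((hermite q x * varphi x * gauss_density x)%:E))%E.

Definition cov_kernel {dE} {E : measurableType dE} {dO} {O : measurableType dO}
  (P : probability O R) (B : E -> O -> R) (x y : E) : R :=
  fine (expectation P (fun w => B x w * B y w)).

(* centered Gaussian field: every finite linear combination S = sum_i c_i B_{x_i}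
   has characteristic function E[exp(i S)] = exp(-Var/2), with
   Var = sum_{i,j} c_i c_j K(x_i,x_j) *)
Definition centered_gaussian_field {dE} {E : measurableType dE} {dO}
  {O : measurableType dO} (P : probability O R) (B : E -> O -> R) : Prop :=
  forall (n : nat) (x : 'I_n -> E) (c : 'I_n -> R),
    let S := fun w => \sum_(i < n) c i * B (x i) w in
    let v := \sum_(i < n) \sum_(j < n) c i * c j * cov_kernel P B (x i) (x j) in
    expectation P (fun w => cos (S w)) = (expR (- v / 2))%:E /\
    expectation P (fun w => sin (S w)) = 0%E.

Definition kernel_moment {dE} {E : measurableType dE}
  (mu : {finite_measure set E -> \bar R}) (K : E -> E -> R) (q : nat) : R :=
  fine (\int[(mu \x mu)%E]_(z in setT) ((K z.1 z.2 ^+ q)%:E))%E.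

(* Y(varphi) in D^{p,2} iff sum_q q^p q! a_q^2 I_q < oo *)
Definition in_Dp2 {dE} {E : measurableType dE}
  (mu : {finite_measure set E -> \bar R}) (K : E -> E -> R)
  (varphi : R -> R) (p : nat) : Prop :=
  (\sum_(0 <= q <oo)
     ((q%:R ^+ p * q`!%:R * hermite_coef varphi q ^+ 2 * kernel_moment mu K q)%:E)
   < +oo)%E.

Definition asymp (f g : nat -> R) : Prop :=
  (\forall q \near \oo, 0 < f q /\ 0 < g q) /\
  (exists M : R, \forall q \near \oo, f q / g q <= M) /\
  (exists M : R, \forall q \near \oo, g q / f q <= M).

End defs.

(* Main.v *)
(* Integrating by parts, [a_q(1_[u,oo)) = H_{q-1}(u) phi(u) / q!], so for q >= 1 the q-th
   term of the series is [phi(u)^2 q^(p-1) H_{q-1}(u)^2/(q-1)!] times a factor of order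
   [q^(-beta)].  Hence everything rests on the size of [h_n := H_n(u)^2/n!], which is of
   order [n^(-1/2)] on average over two consecutive indices; a single [h_n] may vanish.
   With [S_n := h_0 + ... + h_n], the confluent Christoffel-Darboux identity gives
   [S_n = (n+1)(h_n + h_{n+1}) (1 + O(n^(-1/2)))], that is
   [S_{n+1}/S_{n-1} = 1 + 1/(n+1) + O(n^(-3/2))].  So [S_n S_{n+1}/(n+1)] stays between
   two positive constants, [S_n] is of order [n^(1/2)], and [h_n + h_{n+1}] of order
   [n^(-1/2)].  The series then compares with [sum q^(p-3/2-beta)]. *)
Require Import Defs.
From HB Require Import structures.
From mathcomp Require Import all_boot all_order all_algebra.
From mathcomp Require Import all_classical all_reals all_analysis.
From mathcomp Require Import measurable_realfun ring lra.
Set Implicit Arguments.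
Unset Strict Implicit.
Unset Printing Implicit Defensive.
Import Order.TTheory GRing.Theory Num.Theory.
Import numFieldNormedType.Exports.
Local Open Scope classical_set_scope.
Local Open Scope ring_scope.

(** * Bounds for real sums and series *)

Lemma sum_powRN_bounded (R : realType) (s : R) : 0 < s ->
  exists M : R, forall n : nat, \sum_(0 <= k < n) k.+1%:R `^ (- (1 + s)) <= M.
Proof.
move=> s0; exists ((2 + s) / s) => n.
(* Telescoping majorant, with [x = k + 1]: since [(1 + 1/x)^s >= 1 + s ln (1 + 1/x) >= 1 + s/(x+1)],
   the difference is at least [x^(-s) s/(x+1+s)], and [x + 1 + s <= (2 + s) x] as [x >= 1]. *)
have step k : k.+1%:R `^ (- (1 + s)) <=
    (2 + s) / s * (k.+1%:R `^ (- s) - k.+2%:R `^ (- s)) :> R.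
  have k0 : 0 < k.+1%:R :> R by [].
  set x : R := k.+1%:R in k0 *.
  have x1 : 1 <= x by rewrite ler1n.
  have -> : k.+2%:R = x + 1 :> R by rewrite -natr1.
  have -> : x `^ (- (1 + s)) = x `^ (- s) / x.
    by rewrite opprD addrC powRD ?(gt_eqF k0) ?implybT// (powRN _ 1) powRr1 ?ltW.
  have -> : (x + 1) `^ (- s) = x `^ (- s) * (1 + x^-1) `^ (- s).
    rewrite -powRM ?ltW ?addr_gt0 ?invr_gt0//; congr (_ `^ _).
    by rewrite mulrDr mulr1 divff ?gt_eqF.
  set z := x `^ (- s); have z0 : 0 < z by exact: powR_gt0.
  have y0 : 0 < 1 + x^-1 by rewrite addr_gt0 ?invr_gt0.
  have : (1 + x^-1) `^ (- s) <= (x + 1) / (x + 1 + s).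
    rewrite powRN -[leRHS]invf_div lef_pV2 ?posrE ?powR_gt0 ?divr_gt0 ?addr_gt0 ?invr_gt0//.
    rewrite /powR gt_eqF//.
    have lny : (x + 1)^-1 <= ln (1 + x^-1).
      have := @le_ln1Dx R (- (x + 1)^-1).
      have -> : 1 + - (x + 1)^-1 = (1 + x^-1)^-1.
        field; apply/andP; split; apply: lt0r_neq0; lra.
      rewrite lnV// lerN2; apply; rewrite ltrN2 invf_lt1; lra.
    apply: (@le_trans _ _ (1 + s * ln (1 + x^-1))); last exact: expR_ge1Dx.
    have -> : (x + 1 + s) / (x + 1) = 1 + s * (x + 1)^-1.
      by field; apply: lt0r_neq0; lra.
    by rewrite lerD2l ler_pM2l.
  set w := _ `^ _ => hw.
  have : z / x <= (2 + s) / s * (z * (s / (x + 1 + s))).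
    have -> : (2 + s) / s * (z * (s / (x + 1 + s))) = z * ((2 + s) / (x + 1 + s)).
      by field; apply/andP; split; apply: lt0r_neq0; lra.
    rewrite ler_pM2l// ler_pdivlMr; last lra.
    rewrite mulrC ler_pdivrMr//; nra.
  move=> /le_trans; apply.
  rewrite ler_pM2l ?divr_gt0 ?addr_gt0//.
  rewrite -{2}[z]mulr1 -mulrBr ler_pM2l//.
  have -> : s / (x + 1 + s) = 1 - (x + 1) / (x + 1 + s).
    by field; apply: lt0r_neq0; lra.
  by rewrite lerB.
apply: (le_trans (ler_sum _ (fun k _ => step k))).
rewrite -mulr_sumr.
have -> : \sum_(0 <= k < n) (k.+1%:R `^ (- s) - k.+2%:R `^ (- s)) =
    1 - n.+1%:R `^ (- s) :> R.
  rewrite (telescope_sumr_eq (V := R) (n := 0) (m := n) (fun k => - k.+1%:R `^ (- s)))//.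
    by rewrite powR1 opprK addrC.
  by move=> k _; rewrite opprK addrC.
by rewrite -[leRHS]mulr1 ler_pM2l ?divr_gt0 ?addr_gt0// gerBl powR_ge0.
Qed.

(** A discrete Gronwall bound: [1 + b <= exp b] turns the product of the growth factors into the
    exponential of a bounded sum. *)
Lemma perturbed_growth_bounded (R : realType) (a b : nat -> R) (M : R) (N : nat) :
  (forall n, 0 < a n) -> (forall n, 0 <= b n) ->
  (forall n, \sum_(0 <= k < n) b k <= M) ->
  (forall n, (N <= n)%N -> a n.+1 <= a n * (1 + b n)) ->
  exists2 C, 0 < C & forall n, (N <= n)%N -> a n <= C.
Proof.
move=> a0 b0 bM ab; exists (a N * expR M); first by rewrite mulr_gt0 ?expR_gt0.
move=> n Nn; apply: (@le_trans _ _ (a N * expR (\sum_(N <= k < n) b k))).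
  rewrite -(subnK Nn); elim: (n - N)%N => [|k IH].
    by rewrite add0n big_geq// expR0 mulr1.
  rewrite addSn big_nat_recr ?leq_addl//= expRD mulrA.
  apply: le_trans (ab _ (leq_addl _ _)) _.
  by apply: ler_pM; rewrite ?addr_ge0 ?expR_ge1Dx// ltW.
rewrite ler_pM2l// ler_expR; apply: le_trans (bM n).
rewrite (big_cat_nat (leq0n N) Nn)/= lerDr.
by apply: sumr_ge0.
Qed.

(** An asymptotic hypothesis controls signs only eventually, hence the threshold [N]; the finitely
    many earlier terms shift the partial sums by a constant. *)
Lemma eseries_lt_pinftyP (R : realType) (t : nat -> R) (N : nat) :
  (forall q, (N <= q)%N -> 0 <= t q) ->
  (\sum_(0 <= q <oo) (t q)%:E < +oo)%E <->
  exists M : R, forall n, \sum_(N <= k < n) t k <= M.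
Proof.
move=> t0.
have nd : nondecreasing_seq (fun n => \sum_(N <= k < n) t k).
  apply/nondecreasing_seqP => n.
  have [Nn|nN] := leqP N n; last by rewrite !big_geq// ltnW.
  by rewrite big_nat_recr//= lerDl t0.
have E n : (\sum_(0 <= q < n) (t q)%:E = (series t n)%:E)%E.
  by rewrite sumEFin.
rewrite (_ : (fun n => _) = EFin \o series t); last exact/funext.
split=> [tlt|[M tM]]; last first.
  have : cvgn (series t).
    rewrite -(is_cvg_series_restrict N).
    by apply: nondecreasing_is_cvgn => //; exists M => _ [n _ <-]; exact: tM.
  by move=> /EFin_lim ->; rewrite ltry.
apply: contrapT => nb.
have : (fun n => \sum_(N <= k < n) t k) @ \oo --> +oo.
  apply: nondecreasing_dvgn_lt => // cv; apply: nb.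
  by exists (limn (fun n => \sum_(N <= k < n) t k)) => n; exact: nondecreasing_cvgn_le.
move=> /cvgryPge dv.
have : series t @ \oo --> +oo.
  apply/cvgryPge => A.
  have := dv (A - \sum_(0 <= k < N) t k).
  apply: filterS2 (nbhs_infty_ge N) => n Nn.
  by rewrite /series/= (big_cat_nat (leq0n N) Nn)/= lerBlDl.
move=> /cvgeryP /cvg_lim H.
by move: tlt; rewrite H// ltxx.
Qed.

Lemma le_sqrt_nat (R : realType) (c : R) :
  exists N, forall n, (N <= n)%N -> c <= Num.sqrt n%:R.
Proof.
exists (Num.bound (c ^+ 2)) => n Nn.
rewrite (le_trans (ler_norm c))// -sqrtr_sqr ler_sqrt//.
by rewrite ltW// (lt_le_trans (archi_boundP (sqr_ge0 c)))// ler_nat.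
Qed.

(** * Pointwise size of Hermite polynomials *)

Lemma hermite_rec (R : realType) n (x : R) :
  hermite n.+2 x = x * hermite n.+1 x - n.+1%:R * hermite n x.
Proof. by rewrite /hermite /=; case: (hermite_pair n x). Qed.

Section pointwise_growth.
Context {R : realType}.
Variable u : R.
Implicit Types n : nat.

(** The square at [u] of the orthonormal Hermite polynomial of degree [n]; its partial sum [S n] is
    the Christoffel-Darboux kernel on the diagonal. *)
Let h2 n := hermite n u ^+ 2 / n`!%:R.
Let S n := \sum_(0 <= k < n.+1) h2 k.

Lemma natr_fact_gt0 n : 0 < n`!%:R :> R.
Proof. by rewrite ltr0n fact_gt0. Qed.

Lemma sqr_hermite_fact_ge0 n : 0 <= h2 n.
Proof. by rewrite divr_ge0 ?sqr_ge0. Qed.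

Lemma christoffel_sum_gt0 n : 0 < S n.
Proof.
rewrite /S big_nat_recl// ltr_wpDr//.
  by apply: sumr_ge0 => i _; exact: sqr_hermite_fact_ge0.
by rewrite /h2 /hermite/= expr1n fact0 divr1.
Qed.

Lemma christoffel_sumS n : S n.+1 = S n + h2 n.+1.
Proof. by rewrite /S big_nat_recr. Qed.

(** The confluent form [(H_{n+1}' H_n - H_{n+1} H_n') / n!] with derivatives eliminated by
    [H_{n+1}' = (n+1) H_n] and [H_n' = u H_n - H_{n+1}]. *)
Lemma hermite_christoffel_darboux n :
  S n = (hermite n.+1 u ^+ 2 - u * hermite n.+1 u * hermite n u +
         n.+1%:R * hermite n u ^+ 2) / n`!%:R.
Proof.
elim: n => [|n IH].
  by rewrite /S big_nat1 /h2 /hermite /= fact0; ring.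
rewrite christoffel_sumS IH /h2 hermite_rec factS natrM -[n.+2%:R]natr1.
have := natr_fact_gt0 n; have : 0 < n.+1%:R :> R by [].
move: (n.+1%:R : R) (n`!%:R : R) => a b a0 b0.
by field; rewrite !gt_eqF.
Qed.

(** The error is the cross term [u H_n H_{n+1} / n!]. The weighted inequality
    [a b <= (s a^2 + b^2/s) / 2] with [s = sqrt (n+1)] balances the two squares. *)
Lemma christoffel_sum_approx n : `|S n - n.+1%:R * (h2 n + h2 n.+1)| <=
  `|u| / 2 * (Num.sqrt n.+1%:R * (h2 n + h2 n.+1)).
Proof.
have -> : S n - n.+1%:R * (h2 n + h2 n.+1) =
    - u * (hermite n.+1 u * hermite n u / n`!%:R).
  rewrite hermite_christoffel_darboux /h2 factS natrM.
  by field; rewrite !gt_eqF ?natr_fact_gt0.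
rewrite normrM normrN -[leRHS]mulrA ler_wpM2l//.
set s := Num.sqrt _.
have s0 : 0 < s by rewrite sqrtr_gt0.
have ss : n.+1%:R = s ^+ 2 by rewrite sqr_sqrtr.
rewrite normrM (ger0_norm (x := _^-1)) ?invr_ge0//.
rewrite /h2 factS natrM ss.
have -> : 2^-1 * (s * (hermite n u ^+ 2 / n`!%:R +
    hermite n.+1 u ^+ 2 / (s ^+ 2 * n`!%:R))) =
  (s * hermite n u ^+ 2 + hermite n.+1 u ^+ 2 / s) / 2 / n`!%:R.
  by field; rewrite !gt_eqF ?natr_fact_gt0.
rewrite ler_pM2r ?invr_gt0 ?natr_fact_gt0// normrM.
rewrite -(real_normK (num_real (hermite n u))) -(real_normK (num_real (hermite n.+1 u))).
move: (`|hermite n u|) (`|hermite n.+1 u|) => a b.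
have -> : (s * a ^+ 2 + b ^+ 2 / s) / 2 = a * b + (s * a - b) ^+ 2 / (2 * s).
  by field; rewrite gt_eqF.
by rewrite mulrC lerDl divr_ge0 ?sqr_ge0// ltW// mulr_gt0.
Qed.

Let c := `|u| / 2.
(** In the ratio of consecutive values [S n.+1] cancels, leaving [S n.+2 / S n] times [(n+1)/(n+2)];
    the terms of order [1/n] compensate. *)
Let W n := S n * S n.+1 / n.+1%:R.

Lemma christoffel_prod_gt0 n : 0 < W n.
Proof. by rewrite /W !mulr_gt0 ?christoffel_sum_gt0 ?invr_gt0. Qed.

Lemma christoffel_prod_step n (s := Num.sqrt n.+2%:R) :
  2 * (c * s + 1) <= n.+2%:R ->
  W n.+1 <= W n * (1 + 2 * (c + 1) / s ^+ 3) /\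
  W n <= W n.+1 * (1 + 2 * (c + 1) / s ^+ 3).
Proof.
move=> hs.
have := christoffel_sum_approx n.+1; rewrite -/c -/s.
have Sn := christoffel_sum_gt0 n; have Sn1 := christoffel_sum_gt0 n.+1.
have Sn2 := christoffel_sum_gt0 n.+2.
have E2 : S n.+2 = S n + (h2 n.+1 + h2 n.+2) by rewrite !christoffel_sumS addrA.
have E1 := christoffel_sumS n.
have h1 := sqr_hermite_fact_ge0 n.+1; have h2' := sqr_hermite_fact_ge0 n.+2.
have c0 : 0 <= c by rewrite divr_ge0.
have s0 : 1 <= s by rewrite -[leLHS]sqrtr1 ler_sqrt// ler1n.
have ss : n.+2%:R = s ^+ 2 by rewrite sqr_sqrtr.
have ss1 : n.+1%:R = s ^+ 2 - 1 by rewrite -ss -[n.+2%:R]natr1 addrK.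
move: hs; rewrite /W ss ss1.
move: (S n) (S n.+1) (S n.+2) Sn Sn1 Sn2 E1 E2 => x y z x0 y0 z0.
move: (h2 n.+1) (h2 n.+2) h1 h2' => h k h0 k0 E1 E2.
set e := h + k in E2 *.
have he : h <= e by rewrite lerDl.
have e0 : 0 <= e by rewrite addr_ge0.
move: e h0 he e0 E2 => {k0} e h0 he e0 -> hs.
rewrite ler_norml => /andP[ye1 ye2].
have s2 : 2 <= s ^+ 2 by rewrite -ss ler_nat.
have sp : 0 < s by lra.
have t0 : 0 < s ^+ 2 - 1 by lra.
have xe0 : 0 <= x + e by rewrite addr_ge0// ltW.
split.
(* The claim with [y] cancelled and denominators cleared. It follows from
   [x >= y - e >= e (s^2 - c s - 1)], the hypothesis [hs] absorbing the lower-order terms. *)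
- have key : (x + e) * (s ^+ 2 - 1) * s <= x * (s ^+ 3 + 2 * (c + 1)).
    have eu : e * (s ^+ 2 - (c * s + 1)) <= x by lra.
    have : e * ((s ^+ 2 - 1) * s) <=
        e * ((s ^+ 2 - (c * s + 1)) * (s + 2 * (c + 1))).
      by apply: ler_wpM2l => //; nra.
    have : e * (s ^+ 2 - (c * s + 1)) * (s + 2 * (c + 1)) <= x * (s + 2 * (c + 1)).
      by apply: ler_wpM2r => //; lra.
    lra.
  have -> : y * (x + e) / s ^+ 2 =
      (x + e) * (s ^+ 2 - 1) * s * (y / (s ^+ 3 * (s ^+ 2 - 1))).
    by field; rewrite !gt_eqF.
  have -> : x * y / (s ^+ 2 - 1) * (1 + 2 * (c + 1) / s ^+ 3) =
      x * (s ^+ 3 + 2 * (c + 1)) * (y / (s ^+ 3 * (s ^+ 2 - 1))).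
    by field; rewrite !gt_eqF.
  by apply: ler_wpM2r => //; rewrite divr_ge0 ?mulr_ge0 ?exprn_ge0 ?ltW.
(* Conversely [x <= y <= e g] gives [x (g + 1) <= (x + e) g], a lower bound on the growth from [x]
   to [x + e]. *)
- have key : x * s ^+ 5 <= (x + e) * (s ^+ 2 - 1) * (s ^+ 3 + 2 * (c + 1)).
    set g := s ^+ 2 + c * s.
    have g0 : 0 < g.
      by have : 0 <= c * s; [rewrite mulr_ge0// ltW | rewrite /g; lra].
    have xg : x <= e * g by rewrite /g; lra.
    rewrite -(ler_pM2r g0).
    have s30 : 0 <= s ^+ 3 + 2 * (c + 1).
      by rewrite addr_ge0 ?exprn_ge0 ?mulr_ge0 ?addr_ge0// ltW.
    have : x * (g + 1) * ((s ^+ 2 - 1) * (s ^+ 3 + 2 * (c + 1))) <=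
        (x + e) * g * ((s ^+ 2 - 1) * (s ^+ 3 + 2 * (c + 1))).
      by apply: ler_wpM2r; [rewrite mulr_ge0// ltW | lra].
    have : x * (g * s ^+ 5) <=
        x * ((g + 1) * ((s ^+ 2 - 1) * (s ^+ 3 + 2 * (c + 1)))).
      rewrite ler_pM2l//.
      have -> : (g + 1) * ((s ^+ 2 - 1) * (s ^+ 3 + 2 * (c + 1))) = g * s ^+ 5 +
          (2 * (c + 1) * (g * s ^+ 2 - (c * s + 1)) - (c * s + 1) * s ^+ 3).
        by rewrite /g; ring.
      rewrite lerDl subr_ge0.
      have g1 : s ^+ 2 <= g by rewrite lerDl mulr_ge0// ltW.
      have : (c * s + 1) * s ^+ 3 <= (c + 1) * s * s ^+ 3.
        by apply: ler_wpM2r; [rewrite exprn_ge0// ltW | lra].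
      have : (c + 1) * (s ^+ 2 * s ^+ 2) <= (c + 1) * (g * s ^+ 2).
        by apply: ler_wpM2l; [lra | rewrite ler_pM2r// exprn_gt0].
      have : (c + 1) * (2 * (c * s + 1)) <= (c + 1) * (g * s ^+ 2).
        apply: ler_wpM2l; first lra.
        apply: (le_trans hs); apply: (le_trans g1).
        by rewrite ler_peMr// ?ltW//; lra.
      lra.
    lra.
  have -> : x * y / (s ^+ 2 - 1) = x * s ^+ 5 * (y / (s ^+ 5 * (s ^+ 2 - 1))).
    by field; rewrite !gt_eqF.
  have -> : y * (x + e) / s ^+ 2 * (1 + 2 * (c + 1) / s ^+ 3) =
      (x + e) * (s ^+ 2 - 1) * (s ^+ 3 + 2 * (c + 1)) * (y / (s ^+ 5 * (s ^+ 2 - 1))).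
    by field; rewrite !gt_eqF.
  by apply: ler_wpM2r => //; rewrite divr_ge0 ?mulr_ge0 ?exprn_ge0 ?ltW.
Qed.

Lemma christoffel_prod_bounded : exists C N, 0 < C /\
  forall n, (N <= n)%N -> W n <= C /\ (W n)^-1 <= C.
Proof.
have c0 : 0 <= c by rewrite divr_ge0.
have [M0 hM] := @sum_powRN_bounded R 2^-1 (ltac:(by rewrite invr_gt0)).
pose b n := 2 * (c + 1) / Num.sqrt n.+2%:R ^+ 3.
have b0 n : 0 <= b n by rewrite divr_ge0 ?mulr_ge0 ?addr_ge0 ?exprn_ge0 ?sqrtr_ge0.
have bE n : b n = 2 * (c + 1) * n.+2%:R `^ (- (1 + 2^-1)).
  rewrite powRN powRD ?pnatr_eq0 ?implybT// powRr1// powR12_sqrt//.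
  by rewrite -[in RHS](sqr_sqrtr (ler0n R n.+2)) sqrtr_sqr ger0_norm// -exprSr.
have bM n : \sum_(0 <= k < n) b k <= 2 * (c + 1) * M0.
  rewrite (eq_bigr _ (fun k _ => bE k)) -mulr_sumr ler_wpM2l ?mulr_ge0 ?addr_ge0//.
  by apply: le_trans (hM n.+1); rewrite big_nat_recl// lerDr powR_ge0.
(* For [s >= 2c + 2] one has [2 (c s + 1) <= (2c + 2) s <= s^2], the condition of the step lemma. *)
have [N hN] := @le_sqrt_nat R (2 * c + 2).
have step n : (N <= n)%N -> W n.+1 <= W n * (1 + b n) /\ W n <= W n.+1 * (1 + b n).
  move=> Nn; apply: christoffel_prod_step.
  have := hN n.+2 (leq_trans Nn (leq_trans (leqnSn _) (leqnSn _))).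
  have : n.+2%:R = Num.sqrt n.+2%:R ^+ 2 :> R by rewrite sqr_sqrtr.
  move: (Num.sqrt _) => s -> hs.
  have : (2 * c + 2) * s <= s * s by apply: ler_wpM2r => //; lra.
  rewrite expr2; lra.
have [C1 C10 h1] := @perturbed_growth_bounded R W b _ N christoffel_prod_gt0 b0 bM
  (fun n Nn => (step n Nn).1).
have [] := @perturbed_growth_bounded _ (fun n => (W n)^-1) b _ N _ b0 bM.
  by move=> n; rewrite invr_gt0 christoffel_prod_gt0.
  move=> n /step[_ h]; rewrite [leRHS]mulrC ler_pdivlMr ?christoffel_prod_gt0//.
  by rewrite mulrC ler_pdivrMr ?christoffel_prod_gt0// mulrC.
move=> C2 C20 h2'; exists (C1 + C2), N; split; first by rewrite addr_gt0.
move=> n Nn; split.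
  by rewrite (le_trans (h1 _ Nn))// lerDl ltW.
by rewrite (le_trans (h2' _ Nn))// lerDr ltW.
Qed.

(** Since [S] is nondecreasing, [S_n S_{n+1} <= S_{n+1}^2 <= S_{n+1} S_{n+2}], so the bounds on [W]
    fix the order of [S_{n+1}], and Christoffel-Darboux transfers it to the pair of terms. *)
Lemma hermite_sqr_asymp : exists C N, 0 < C /\ forall n, (N <= n)%N ->
  h2 n + h2 n.+1 <= C / Num.sqrt n.+1%:R /\
  C^-1 / Num.sqrt n.+1%:R <= h2 n + h2 n.+1.
Proof.
have c0 : 0 <= c by rewrite divr_ge0.
have [C [N [C0 hC]]] := christoffel_prod_bounded.
have [N' hN'] := @le_sqrt_nat R (2 * c).
(* The factor [1 + 2C] dominates the square roots of [C] and [2C]; the factor 2 compares [S] with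
   [s^2 e], as [c s <= s^2/2]. The successor leaves room for both [W_n] and [W_{n+1}]. *)
exists (2 * (1 + 2 * C)), (maxn N N').+1; split.
  by rewrite mulr_gt0 ?addr_gt0 ?mulr_gt0.
case=> // n; rewrite ltnS geq_max => /andP[Nn N'n].
have := hN' n.+2 (leq_trans N'n (leq_trans (leqnSn _) (leqnSn _))).
have [Wn1 _] := hC n.+1 (leq_trans Nn (leqnSn _)).
have [_ Wn] := hC n Nn.
have := christoffel_sum_approx n.+1; rewrite -/c.
have e0 : 0 <= h2 n.+1 + h2 n.+2 by rewrite addr_ge0 ?sqr_hermite_fact_ge0.
have ss : n.+2%:R = Num.sqrt n.+2%:R ^+ 2 :> R by rewrite sqr_sqrtr.
have s0 : 1 <= Num.sqrt n.+2%:R :> R by rewrite -[leLHS]sqrtr1 ler_sqrt// ler1n.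
have ss1 : n.+1%:R = Num.sqrt n.+2%:R ^+ 2 - 1 :> R.
  by rewrite -ss -[n.+2%:R]natr1 addrK.
have s2 : 2 <= Num.sqrt n.+2%:R ^+ 2 :> R by rewrite -ss ler_nat.
have y0 := christoffel_sum_gt0 n.+1.
have y1 : S n.+1 * S n.+1 <= C * Num.sqrt n.+2%:R ^+ 2.
  rewrite -ss -ler_pdivrMr//; apply: le_trans Wn1.
  by rewrite ler_pM2r ?invr_gt0// ler_pM2l// (christoffel_sumS n.+1) lerDl sqr_hermite_fact_ge0.
have y2 : Num.sqrt n.+2%:R ^+ 2 - 1 <= C * (S n.+1 * S n.+1).
  rewrite -ss1; move: Wn; rewrite /W invf_div ler_pdivrMr ?mulr_gt0 ?christoffel_sum_gt0//.
  move=> /le_trans; apply; rewrite ler_pM2l// ler_pM2r// christoffel_sumS.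
  by rewrite lerDl sqr_hermite_fact_ge0.
move: s0 s2 y1 y2 ss {ss1}.
move: (Num.sqrt _) (S n.+1) y0 (h2 n.+1 + h2 n.+2) e0 => s y y0 e e0 s1 s2 y1 y2 ->.
rewrite ler_norml => /andP[l1 l2] hs.
have sp : 0 < s by lra.
have cs : 2 * (c * (s * e)) <= s ^+ 2 * e.
  have : 2 * c * (s * e) <= s * (s * e) by rewrite ler_wpM2r// mulr_ge0// ltW.
  by rewrite expr2; lra.
have ylt : y <= (1 + 2 * C) * s.
  have a0 : 0 <= (1 + 2 * C) * s by rewrite mulr_ge0 ?addr_ge0 ?mulr_ge0// ltW.
  rewrite -ler_sqr ?nnegrE// ?(ltW y0)//.
  rewrite exprMn [y ^+ 2]expr2; apply: le_trans y1 _.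
  by rewrite ler_pM2r ?exprn_gt0//; nra.
have ygt : s <= (1 + 2 * C) * y.
  have a0 : 0 <= (1 + 2 * C) * y by rewrite mulr_ge0 ?addr_ge0 ?mulr_ge0// ltW.
  rewrite -ler_sqr ?nnegrE// ?(ltW sp)//.
  rewrite exprMn [y ^+ 2]expr2.
  apply: (@le_trans _ _ (2 * C * (y * y))); first lra.
  by rewrite ler_pM2r ?mulr_gt0//; nra.
split.
  rewrite ler_pdivlMr// -(ler_pM2r sp); apply: (@le_trans _ _ (2 * y)).
    by rewrite -mulrA -expr2 mulrC; lra.
  by rewrite -mulrA ler_pM2l.
rewrite -invfM -[leLHS]mul1r ler_pdivrMr; last by rewrite !mulr_gt0 ?addr_gt0 ?mulr_gt0.
rewrite -(ler_pM2r sp) mul1r; apply: (le_trans ygt).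
have : y <= 2 * (s ^+ 2 * e) by nra.
have C1 : 0 < 1 + 2 * C by lra.
rewrite -(ler_pM2l C1); lra.
Qed.

End pointwise_growth.

(** * Hermite coefficients of a half-line indicator *)

Lemma hermite_succ (R : realType) n x :
  hermite n.+1 x = x * hermite n x - n%:R * hermite n.-1 x :> R.
Proof.
case: n => [|n]; last exact: hermite_rec.
by rewrite /hermite /= mulr1 mul0r subr0.
Qed.

Global Instance is_derive_hermite (R : realType) n (x : R) :
  is_derive x 1 (hermite n) (n%:R * hermite n.-1 x).
Proof.
(* The three-term recurrence calls for two consecutive degrees. At degree 0 the coefficient 0 hides
   the default [0.-1 = 0]. *)
suff : is_derive x 1 (hermite n) (n%:R * hermite n.-1 x) /\
    is_derive x 1 (hermite n.+1) (n.+1%:R * hermite n x) by case.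
elim: n => [|n [IH1 IH2]].
  split.
    by rewrite mul0r (_ : hermite 0 = cst 1)//; exact: is_derive_cst.
  rewrite (_ : hermite 1 = id)// /hermite/= mulr1.
  exact: is_derive_id.
split=> //.
rewrite (_ : hermite n.+2 = (fun y => y * hermite n.+1 y - n.+1%:R * hermite n y)); last first.
  by apply/funext => y; rewrite hermite_rec.
apply: is_derive_eq.
rewrite !scaler1.
rewrite !/GRing.scale/=.
rewrite -[n.+2%:R]natr1 mulrDl mul1r.
rewrite {2}(hermite_succ n).
ring.
Qed.

Global Instance is_derive_gauss_density (R : realType) (x : R) :
  is_derive x 1 (@gauss_density R) (- x * gauss_density x).
Proof.
have -> : @gauss_density R =
    (Num.sqrt (pi *+ 2))^-1 \*: (expR \o ((- 2^-1) \*: (id ^+ 2 : R -> R))).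
  apply/funext => y; rewrite /gauss_density/= mulrC; congr (_ * expR _).
  by rewrite mulNr mulrC -mulNr.
apply: is_derive_eq.
rewrite /GRing.scale/= /GRing.scale/=; field.
by rewrite gt_eqF// sqrtr_gt0 mulrn_wgt0 ?pi_gt0.
Qed.

Lemma is_derive_hermite_gauss (R : realType) n (x : R) :
  is_derive x 1 (fun y => - (hermite n y * gauss_density y))
    (hermite n.+1 x * gauss_density x).
Proof.
apply: is_derive_eq.
rewrite /GRing.scale/= hermite_succ; ring.
Qed.

(** For such [x] the values [H_0(x), ..., H_n(x)] are nondecreasing: [x H_{k+1} - (k+1) H_k >= (k+2)
    H_{k+1} - (k+1) H_{k+1}]. This monotonicity carries the induction. *)
Lemma hermite_ge0_le_exp (R : realType) n (x : R) : n%:R <= x -> 1 <= x ->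
  0 <= hermite n x <= x ^+ n.
Proof.
move=> nx x1.
suff H k : (k <= n)%N -> 0 <= hermite k.-1 x <= hermite k x /\ hermite k x <= x ^+ k.
  by have [/andP[a b] c] := H n (leqnn n); rewrite (le_trans a b).
elim: k => [_|[_ _|k IH kn]].
- by rewrite /hermite/= ler01 lexx.
- by rewrite /hermite/= ler01 x1 lexx.
- have [/andP[a b] c] := IH (ltnW kn).
  have h0 := le_trans a b.
  have k2 : k.+2%:R <= x by apply: le_trans nx; rewrite ler_nat.
  move: k2; rewrite -natr1 => k2.
  have k0 : 0 <= k.+1%:R :> R by [].
  move: a b; rewrite [k.+1.-1]/= => a b.
  rewrite [k.+2.-1]/= hermite_rec exprS; split.
    rewrite h0/=.
    have : k.+1%:R * hermite k x <= k.+1%:R * hermite k.+1 x by rewrite ler_wpM2l.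
    have : (k.+1%:R + 1) * hermite k.+1 x <= x * hermite k.+1 x by rewrite ler_wpM2r.
    lra.
  have : x * hermite k.+1 x <= x * x ^+ k.+1 by rewrite ler_wpM2l// (le_trans ler01).
  have : 0 <= k.+1%:R * hermite k x by rewrite mulr_ge0.
  lra.
Qed.

Lemma hermite_gauss_cvg0 (R : realType) n :
  (- (hermite n x * gauss_density x) : R) @[x --> +oo] --> (0 : R).
Proof.
rewrite -oppr0; apply: cvgN.
(* From [exp (x^2/2) >= (x^2/2)^(n+1) / (n+1)!], one term of the exponential series. *)
pose K : R := 2 ^+ n.+1 * n.+1`!%:R / Num.sqrt (pi *+ 2).
have c0 : 0 < Num.sqrt (pi *+ 2) :> R by rewrite sqrtr_gt0 mulrn_wgt0 ?pi_gt0.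
apply: (@squeeze_cvgr _ _ _ _ (fun=> 0) (fun x : R => K * x^-1)); last 2 first.
- exact: cvg_cst.
- rewrite -(mulr0 K); apply: cvgMr.
  apply/gtr0_cvgV0; last exact: cvg_id.
  by near=> x; near: x; exact: nbhs_pinfty_gt.
near=> x.
have x1 : 1 <= x by near: x; exact: nbhs_pinfty_ge.
have nx : n%:R <= x by near: x; exact: nbhs_pinfty_ge.
have x0 : 0 < x by apply: lt_le_trans x1.
have /andP[h0 h1] := hermite_ge0_le_exp nx x1.
have g0 : 0 < gauss_density x by rewrite /gauss_density divr_gt0 ?expR_gt0.
apply/andP; split; first by rewrite mulr_ge0// ltW.
apply: (@le_trans _ _ (x ^+ n * gauss_density x)); first by rewrite ler_pM2r.
rewrite /gauss_density mulNr expRN.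
have he : (x ^+ 2 / 2) ^+ n.+1 / n.+1`!%:R <= expR (x ^+ 2 / 2).
  have := @expR_ge1Dxn R (x ^+ 2 / 2) n (ltac:(by rewrite divr_ge0 ?sqr_ge0)).
  by apply: le_trans; rewrite lerDr.
rewrite /K mulrA [leRHS]mulrAC ler_pM2r ?invr_gt0//.
rewrite ler_pdivlMr// mulrAC -exprSr ler_pdivrMr ?expR_gt0//.
have f0 : 0 < n.+1`!%:R :> R by rewrite ltr0n fact_gt0.
move: he; rewrite expr_div_n ler_pdivrMr// ler_pdivrMr ?exprn_gt0//.
rewrite [leRHS]mulrC [leRHS]mulrA mulrAC -mulrA.
apply: le_trans; rewrite -exprM mulnC exprM.
by rewrite ler_eXnr ?exprn_ege1.
Unshelve. all: by end_near. Qed.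

Lemma integral_hermite_gauss (R : realType) n (u : R) :
  (\int[@lebesgue_measure R]_(x in `[u, +oo[)
     (hermite n.+1 x * gauss_density x)%:E = (hermite n u * gauss_density u)%:E)%E.
Proof.
pose F (y : R) := - (hermite n y * gauss_density y).
pose f (y : R) := hermite n.+1 y * gauss_density y.
have dF (x : R) : is_derive x 1 F (f x) by exact: is_derive_hermite_gauss.
have cF x : {for x, continuous F}.
  by apply: differentiable_continuous; apply/derivable1_diffP; exact: ex_derive.
have cf : continuous f.
  move=> x; apply: differentiable_continuous; apply/derivable1_diffP.
  by apply: derivableM; exact: ex_derive.
have F'f x : derive1 F x = f x by rewrite derive1E derive_val.
(* The improper fundamental theorem is applied to a nonnegative integrand, so it is used only beyond
   [n + 1]; the compact piece from [u] to [A] is handled separately, [u + 1] keeping it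
   nondegenerate. *)
pose A := Num.max (u + 1) n.+1%:R.
have uA : u < A by rewrite lt_max ltrDl ltr01.
have nA : n.+1%:R <= A by rewrite le_max lexx orbT.
have A1 : 1 <= A by apply: le_trans nA; rewrite ler1n.
have mf : measurable_fun setT f by apply: continuous_measurable_fun.
rewrite (@itv_bndbnd_setU _ _ _ (BRight A))//; last by rewrite bnd_simp ltW.
rewrite integral_setU//=; last 2 first.
- by apply/measurable_EFinP; apply: measurable_funTS.
- apply/disj_setPS => y [/=]; rewrite !in_itv/= => /andP[_ yA].
  by rewrite ltNge yA.
rewrite integral_itv_obnd_cbnd; last by apply/measurable_EFinP; apply: measurable_funTS.
rewrite (@continuous_FTC2 _ f F u A uA)//; last 2 first.
- by apply: continuous_subspaceT => x; exact: cf.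
- split; first by move=> x _; exact: ex_derive.
  + by apply: cvg_at_right_filter; exact: cF.
  + by apply: cvg_at_left_filter; exact: cF.
rewrite (@ge0_continuous_FTC2y _ f F A 0)//; last 4 first.
- move=> x Ax; rewrite mulr_ge0// /gauss_density ?divr_ge0 ?expR_ge0 ?sqrtr_ge0//.
  by have /andP[] := hermite_ge0_le_exp (le_trans nA Ax) (le_trans A1 Ax).
- by apply: continuous_subspaceT => x; exact: cf.
- exact: hermite_gauss_cvg0.
- by apply: cvg_at_right_filter; exact: cF.
by rewrite /F -!EFinD sub0r addrAC subrr add0r opprK.
Qed.

Lemma hermite_coef_indic (R : realType) n (u : R) :
  hermite_coef (fun x : R => \1_(`[u, +oo[ : set R) x) n.+1 =
  hermite n u * gauss_density u / n.+1`!%:R.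
Proof.
rewrite /hermite_coef mulrC; congr (_ / _).
transitivity (fine (hermite n u * gauss_density u)%:E) => //; congr fine.
rewrite -integral_hermite_gauss [RHS]integral_mkcond.
apply: eq_integral => x _; rewrite patchE indicE.
by case: ifPn => _; rewrite ?mulr1 ?mulr0 ?mul0r.
Qed.

Lemma gauss_density_gt0 (R : realType) (x : R) : 0 < gauss_density x.
Proof.
by rewrite /gauss_density divr_gt0 ?expR_gt0// sqrtr_gt0 mulrn_wgt0 ?pi_gt0.
Qed.

(** * Comparison of the chaos series with power sums *)

Lemma asympP (R : realType) (f g : nat -> R) : asymp f g ->
  exists C N, 0 < C /\
    forall q, (N <= q)%N -> [/\ 0 < f q, f q <= C * g q & g q <= C * f q].
Proof.
move=> [[N0 _ h0] [[M1 [N1 _ h1]] [M2 [N2 _ h2]]]].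
exists (`|M1| + `|M2| + 1), (maxn N0 (maxn N1 N2)); split.
  by rewrite ltr_wpDl ?addr_ge0.
move=> q; rewrite !geq_max => /and3P[/h0[f0 g0] /h1 b1 /h2 b2].
split=> //.
  move: b1; rewrite /= ler_pdivrMr// => /le_trans; apply.
  rewrite ler_pM2r//; have := ler_norm M1; have := normr_ge0 M2; lra.
move: b2; rewrite /= ler_pdivrMr// => /le_trans; apply.
rewrite ler_pM2r//; have := ler_norm M2; have := normr_ge0 M1; lra.
Qed.

Lemma sum_nat_inv_unbounded (R : realType) (N : nat) (M : R) :
  ~ forall n, \sum_(N <= k < n) k.+1%:R^-1 <= M.
Proof.
move=> hM; apply: (@dvg_harmonic R).
rewrite -(is_cvg_series_restrict N); apply: nondecreasing_is_cvgn.
  apply/nondecreasing_seqP => n.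
  have [Nn|nN] := leqP N n; last by rewrite /= !big_geq// ltnW.
  by rewrite /= big_nat_recr//= lerDl.
by exists M => _ [n _ <-]; exact: hM.
Qed.

Lemma eseries_hermite_coef_indic (R : realType) (u beta : R) (I : nat -> R) (p : nat) :
  asymp I (fun q : nat => q%:R `^ (- beta)) ->
  (\sum_(0 <= q <oo) (q%:R ^+ p * q`!%:R *
     hermite_coef (fun x : R => \1_(`[u, +oo[ : set R) x) q ^+ 2 * I q)%:E
   < +oo)%E <-> p%:R < beta + 2^-1.
Proof.
move=> /asympP[D [N0 [D0 hI]]].
have [C [N1 [C0 hh]]] := hermite_sqr_asymp u.
pose h n := hermite n u ^+ 2 / n`!%:R.
have h0 n : 0 <= h n by rewrite divr_ge0 ?sqr_ge0.
pose t q := q%:R ^+ p * q`!%:R *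
  hermite_coef (fun x : R => \1_(`[u, +oo[ : set R) x) q ^+ 2 * I q.
have [G [GE G0]] : exists G : R, G = gauss_density u ^+ 2 /\ 0 < G.
  by exists (gauss_density u ^+ 2); rewrite exprn_gt0 ?gauss_density_gt0.
have tE n : t n.+1 = G * (h n * (n.+1%:R ^+ p / n.+1%:R * I n.+1)).
  rewrite /t hermite_coef_indic GE /h factS natrM.
  field.
  by rewrite nat1r pnatr_eq0/= gt_eqF ?natr_fact_gt0.
(* Up to constants [t n.+1] is [h n] times [(n+1)^a]. *)
pose a : R := p%:R - 1 - beta.
have aE n : n.+1%:R `^ a = n.+1%:R ^+ p / n.+1%:R * n.+1%:R `^ (- beta).
  rewrite /a !powRD ?pnatr_eq0 ?implybT// powR_mulrn// (powRN _ 1) powRr1//.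
have bnd n : (N0 <= n)%N -> n.+1%:R `^ a / D <= n.+1%:R ^+ p / n.+1%:R * I n.+1 /\
    n.+1%:R ^+ p / n.+1%:R * I n.+1 <= D * n.+1%:R `^ a.
  move=> Nn; have [_ b1 b2] := hI n.+1 (leq_trans Nn (leqnSn _)).
  have x0 : 0 < n.+1%:R ^+ p / n.+1%:R :> R by rewrite divr_gt0 ?exprn_gt0.
  rewrite aE; split; last by rewrite mulrCA ler_pM2l.
  by rewrite -[leLHS]mulrA ler_pM2l// ler_pdivrMr// mulrC.
have t0 q : (maxn N0 N1 < q)%N -> 0 <= t q.
  case: q => // n; rewrite ltnS geq_max => /andP[Nn _].
  rewrite tE mulr_ge0 ?(ltW G0)// mulr_ge0// mulr_ge0 ?divr_ge0 ?exprn_ge0//.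
  by have [/ltW] := hI n.+1 (leq_trans Nn (leqnSn _)).
rewrite (eseries_lt_pinftyP t0); split => [[M hM]|hp]; last first.
  (* Chosen so that [a - 1/2 = -(1 + s)]. *)
  pose s : R := beta + 2^-1 - p%:R.
  have s0 : 0 < s by rewrite subr_gt0.
  have [M hM] := sum_powRN_bounded s0.
  exists (G * C * D * M) => n.
  pose f k : R := k%:R `^ (- (1 + s)).
  have f0 k : 0 <= f k by exact: powR_ge0.
  apply: (@le_trans _ _ (\sum_((maxn N0 N1).+1 <= k < n) G * C * D * f k)).
    rewrite big_nat_cond [leRHS]big_nat_cond; apply: ler_sum => -[|k]//.
    rewrite andbT ltnS => /andP[+ _]; rewrite geq_max => /andP[k0 k1].
    have [_ b] := bnd _ k0; have [b' _] := hh _ k1.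
    have -> : G * C * D * f k.+1 = G * (C / Num.sqrt k.+1%:R * (D * k.+1%:R `^ a)).
      have -> : f k.+1 = (Num.sqrt k.+1%:R)^-1 * k.+1%:R `^ a.
        rewrite -powR12_sqrt// -powRN -powRD ?pnatr_eq0 ?implybT//.
        by rewrite /f /a /s; congr (_ `^ _); lra.
      by ring.
    rewrite tE ler_pM2l//.
    apply: ler_pM => //.
      rewrite mulr_ge0 ?divr_ge0 ?exprn_ge0//.
      by have [/ltW] := hI k.+1 (leq_trans k0 (leqnSn _)).
    (* For convergence a single [h k] is bounded by the pair. *)
    by apply: le_trans b'; rewrite lerDl h0.
  rewrite -mulr_sumr ler_pM2l ?mulr_gt0//.
  apply: le_trans (hM n.-1); rewrite -[leRHS](big_add1 _ _ 0 n xpredT f).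
  have [nN|Nn] := leqP n (maxn N0 N1).+1; first by rewrite [leLHS]big_geq//; apply: sumr_ge0.
  by rewrite [leRHS](big_cat_nat (n := (maxn N0 N1).+1))//= 1?ltnW// lerDr; apply: sumr_ge0.
rewrite ltNge; apply/negP => hp.
pose N := (maxn N0 N1).+1.
(* Pairing terms is essential, as one [h] may vanish. Here [a >= -1/2], so both weights are at least
   the smaller [(n+1)^(-1/2) / D], which factors out of the pair and meets its lower bound of order
   [n^(-1/2)]. *)
have dvg n : (N <= n)%N -> G / (D * C) * n.+1%:R^-1 <= t n + t n.+1.
  case: n => // n; rewrite /N ltnS geq_max => /andP[n0 n1].
  have [b1 _] := bnd _ n0; have [b2 _] := bnd _ (leq_trans n0 (leqnSn _)).
  have [_ b'] := hh _ n1.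
  rewrite !tE -mulrDr -[leLHS]mulrA ler_pM2l//.
  have r0 k : 0 < (Num.sqrt k.+1%:R)^-1 :> R by rewrite invr_gt0 sqrtr_gt0.
  have sq k : (Num.sqrt k.+1%:R)^-1 <= k.+1%:R `^ a.
    rewrite -powR12_sqrt// -powRN ler_powR ?ler1n//.
    by rewrite /a; lra.
  have s21 : (Num.sqrt n.+2%:R)^-1 <= (Num.sqrt n.+1%:R)^-1 :> R.
    by rewrite lef_pV2 ?posrE ?sqrtr_gt0// ler_sqrt ?ler_nat.
  apply: (@le_trans _ _ ((h n + h n.+1) * ((Num.sqrt n.+2%:R)^-1 / D))).
    have -> : (D * C)^-1 * n.+2%:R^-1 =
        C^-1 / Num.sqrt n.+2%:R * ((Num.sqrt n.+2%:R)^-1 / D).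
      have -> : n.+2%:R^-1 = (Num.sqrt n.+2%:R)^-1 * (Num.sqrt n.+2%:R)^-1 :> R.
        by rewrite -invfM -expr2 sqr_sqrtr.
      by rewrite invfM; ring.
    rewrite ler_pM2r ?divr_gt0//; apply: le_trans b'.
    by rewrite ler_pM2l ?invr_gt0.
  rewrite mulrDl lerD// ler_wpM2l//.
    apply: le_trans b1; rewrite ler_pM2r ?invr_gt0//.
    exact: le_trans (sq _).
  by apply: le_trans b2; rewrite ler_pM2r ?invr_gt0.
have K0 : 0 < G / (D * C) by rewrite divr_gt0 ?mulr_gt0.
(* [M + M] because each term of the series occurs in at most two pairs. *)
apply: (@sum_nat_inv_unbounded R N ((M + M) / (G / (D * C)))) => n.
rewrite ler_pdivlMr// mulrC mulr_sumr.
apply: (@le_trans _ _ (\sum_(N <= k < n) (t k + t k.+1))).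
  rewrite big_nat_cond [leRHS]big_nat_cond; apply: ler_sum => k.
  by rewrite andbT => /andP[/dvg].
rewrite big_split lerD//= -(big_add1 _ _ N n.+1 xpredT t).
apply: le_trans (hM n.+1).
have [nN|Nn] := leqP n.+1 N; first by rewrite !big_geq// leqW.
by rewrite [leRHS]big_ltn// lerDr t0.
Qed.

Theorem theorem1 (R : realType)
  (dE : measure_display) (E : measurableType dE)
  (mu : {finite_measure set E -> \bar R})
  (dO : measure_display) (O : measurableType dO) (P : probability O R)
  (B : E -> O -> R)
  (B_meas : measurable_fun setT (fun z : E * O => B z.1 z.2))
  (B_gauss : centered_gaussian_field P B)
  (B_var1 : forall x : E, expectation P (fun w => B x w ^+ 2) = 1%:E)
  (beta : R) (beta_gt0 : 0 < beta)
  (hK : asymp (kernel_moment mu (cov_kernel P B))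
              (fun q : nat => q%:R `^ (- beta))) :
  forall (u : R) (p : nat),
    in_Dp2 mu (cov_kernel P B) (fun x : R => \1_(`[u, +oo[ : set R) x) p
    <-> p%:R < beta + 2^-1.
Proof. by move=> u p; exact: eseries_hermite_coef_indic hK. Qed.
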